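(* Let $A_1,A_2\in\mathbb{R}^{n\times n}$ be symmetric matrices, $a,b\in\mathbb{R}^n$, $a_0,b_0\in\mathbb{R}$, and let $f_1(x)=x^TA_1x+2a^Tx+a_0$ and $f_2(x)=x^TA_2x+2b^Tx+b_0$ for $x\in\mathbb{R}^n$. Let $v(\mathrm{Po4})=\inf_{x\in\mathbb{R}^n}\left[(f_1(x))^2+(f_2(x))^2\right]$. If $\{A_1,A_2\}$ is linearly independent, then $$v(\mathrm{Po4})=\sup\left\{\gamma \;:\; \gamma,\alpha,\beta\in\mathbb{R},\ M\succeq 0\right\},$$ where $M=M(\gamma,\alpha,\beta)\in\mathbb{R}^{(n+3)\times(n+3)}$ is the symmetric block matrix (with block sizes $2,n,1$) $$M=\begin{pmatrix} I_2 & 0_{2\times n} & \begin{pmatrix}-\alpha/2\\-\beta/2\end{pmatrix}\\ 0_{n\times 2} & \alpha A_1+\beta A_2 & \alpha a+\beta b\\ \begin{pmatrix}-\alpha/2 & -\beta/2\end{pmatrix} & \alpha a^T+\beta b^T & \alpha a_0+\beta b_0-\gamma\end{pmatrix}.$$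
   Context: $M\succeq 0$ means that the symmetric matrix $M$ is positive semidefinite; $I_2$ is the $2\times 2$ identity matrix and $0_{p\times q}$ is the $p\times q$ zero matrix. Linear independence of $\{A_1,A_2\}$ is in the real vector space of symmetric $n\times n$ matrices. *)

(* Defs.v *)
From HB Require Import structures.
From mathcomp Require Import all_boot all_order all_algebra.
From mathcomp Require Import all_classical all_reals ereal.

Set Implicit Arguments.
Unset Strict Implicit.
Unset Printing Implicit Defensive.

Import Order.TTheory GRing.Theory Num.Theory.
Local Open Scope classical_set_scope.
Local Open Scope ring_scope.

Definition quadratic (R : realType) (n : nat) (A : 'M[R]_n) (a : 'cV[R]_n)
    (a0 : R) (x : 'cV[R]_n) : R :=
  (x^T *m A *m x) 0 0 + 2 * (a^T *m x) 0 0 + a0.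

Definition psdmx (R : realType) (m : nat) (M : 'M[R]_m) : Prop :=
  M^T = M /\ forall x : 'cV[R]_m, 0 <= (x^T *m M *m x) 0 0.

Definition lmi_mx (R : realType) (n : nat) (A1 A2 : 'M[R]_n)
    (a b : 'cV[R]_n) (a0 b0 : R) (gamma alpha beta : R) : 'M[R]_(2 + n + 1) :=
  let c : 'cV[R]_2 := \col_(i < 2) (- (if i == 0 then alpha else beta) / 2) in
  let d : 'cV[R]_n := alpha *: a + beta *: b in
  block_mx (block_mx 1%:M 0 0 (alpha *: A1 + beta *: A2)) (col_mx c d)
           (row_mx c^T d^T) (alpha * a0 + beta * b0 - gamma)%:M.

(* Taken in the extended reals, where the infimum of a set of reals needs no
   convention for empty or unbounded sets. *)
Definition v_Po4 (R : realType) (n : nat) (A1 A2 : 'M[R]_n)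
    (a b : 'cV[R]_n) (a0 b0 : R) : \bar R :=
  ereal_inf (range (fun x : 'cV[R]_n =>
    (quadratic A1 a a0 x ^+ 2 + quadratic A2 b b0 x ^+ 2)%:E)).

(* Main.v *)
(* The linear matrix inequality says that
   gamma <= alpha f1 + beta f2 - (alpha^2 + beta^2) / 4 everywhere, so the
   right-hand side is the Lagrangian dual of minimizing u^2 + v^2 over the joint
   range of (f1, f2), and duality is exact as soon as that range is convex.
   Linear independence gives convexity. Along the line x + s u, u = y - x, the
   joint range is a line or a parabola F(x) + s L + s^2 H; in the second case
   independence provides a direction w whose quadratic image is not parallel to
   H, and moving in the plane spanned by u and w sweeps the chord from F(x) to
   F(y), by the intermediate value theorem. The nearest point p to the origin in
   the closure of the range then gives the multipliers (alpha, beta) = 2 p. *)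

Require Import Defs.
From HB Require Import structures.
From mathcomp Require Import all_boot all_order all_algebra.
From mathcomp Require Import all_classical all_reals ereal.
From mathcomp Require Import ring lra.
From mathcomp Require polyrcf.

Import Order.TTheory GRing.Theory Num.Theory.
Local Open Scope classical_set_scope.
Local Open Scope ring_scope.

(** * Chords of planar parabolas, by the intermediate value theorem *)

Lemma poly_sign_root {R : rcfType} {p : {poly R}} {x y : R} :
  p.[x] <= 0 -> 0 <= p.[y] -> exists r : R, p.[r] = 0.
Proof.
move=> px py; case: (leP x y) => [xy|/ltW yx].
  by have [|r _ /rootP] := @poly_ivt _ p x y xy; [rewrite px|exists r].
have [|r _] := @poly_ivt _ (- p) y x yx.
  by rewrite !hornerN oppr_le0 oppr_ge0 py.
by rewrite rootN => /rootP; exists r.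
Qed.

(* In the coordinates of the basis (H, L), where the parabola is [(s^2, s)], the
   point [(t, t)] of the chord from [s = 0] to [s = 1] is reached. *)
Lemma planar_normal {R : rcfType} (t b w1 l1 c w2 l2 : R) :
  0 <= t <= 1 -> w2 != 0 ->
  exists s r : R, s ^+ 2 + 2 * s * r * b + r ^+ 2 * w1 + r * l1 = t /\
                  s + 2 * s * r * c + r ^+ 2 * w2 + r * l2 = t.
Proof.
move=> /andP[t0 t1] w20.
pose N r := t - r * l2 - r ^+ 2 * w2.
pose g s r := s ^+ 2 + 2 * s * r * b + r ^+ 2 * w1 + r * l1 - t.
(* The second equation is linear in [s]. Eliminating [s] leaves a polynomial in [r] whose value at 0
   is [t ^+ 2 - t <= 0], so one nonnegative value yields a root. *)
suff [s [r [gsr sr]]] : exists s r, g s r = 0 /\ s * (1 + 2 * r * c) = N r.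
  exists s, r; split; first by apply/eqP; rewrite -subr_eq0 -gsr.
  apply/eqP; rewrite -subr_eq0; apply/eqP.
  have -> : s + 2 * s * r * c + r ^+ 2 * w2 + r * l2 - t
    = s * (1 + 2 * r * c) - N r by rewrite /N; ring.
  by rewrite sr subrr.
have [c0|cn0] := eqVneq c 0.
  pose p : {poly R} := Poly [:: t ^+ 2 - t; l1 + 2 * b * t - 2 * t * l2;
    w1 + l2 ^+ 2 - 2 * t * w2 - 2 * b * l2; 2 * l2 * w2 - 2 * b * w2; w2 ^+ 2].
  have pE r : p.[r] = g (N r) r by rewrite horner_Poly /= /g /N; ring.
  have lp : 0 < lead_coef p.
    by rewrite lead_coefE (@PolyK _ 0) /= ?sqrf_eq0// exprn_even_gt0.
  have [m pm] := polyrcf.poly_pinfty_gt_lc lp.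
  have p0 : p.[0] <= 0 by rewrite pE /g /N; nra.
  have [r pr] := poly_sign_root p0 (le_trans (ltW lp) (pm _ (lexx m))).
  by exists (N r), r; rewrite -pE c0 mulr0 addr0 mulr1.
(* The pole of the elimination [s = N r / (1 + 2 * r * c)]. *)
pose r0 := - (2 * c)^-1.
have r0c : 1 + 2 * r0 * c = 0 by rewrite /r0; field; rewrite cn0.
have [N0|Nn0] := eqVneq (N r0) 0.
  (* [N] is divisible by the denominator [1 + 2 r c], with quotient [n]. *)
  pose n r := r0 * (l2 + (r + r0) * w2).
  have nN r : n r * (1 + 2 * r * c) = N r.
    rewrite -[RHS]subr0 -N0 /N /n.
    have -> : 1 + 2 * r * c = 2 * (r - r0) * c by rewrite -[LHS]subr0 -r0c; ring.
    have -> : r0 * (l2 + (r + r0) * w2) * (2 * (r - r0) * c) =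
      (1 + 2 * r0 * c - 1) * (l2 + (r + r0) * w2) * (r - r0) by ring.
    by rewrite r0c; ring.
  pose p : {poly R} := (r0 *: (l2%:P + ('X + r0%:P) * w2%:P)) ^+ 2
    + (2 * b) *: ((r0 *: (l2%:P + ('X + r0%:P) * w2%:P)) * 'X)
    + w1 *: 'X^2 + l1 *: 'X - t%:P.
  have pE r : p.[r] = g (n r) r by rewrite /p !hornerE /= /g /n; ring.
  have p0 : p.[0] <= 0.
    have n0 : n 0 = t.
      by have := nN 0; rewrite mulr0 mul0r addr0 mulr1 /N => ->; ring.
    by rewrite pE n0 /g; nra.
  have [pr0|pr0] := leP 0 p.[r0].
    have [r pr] := poly_sign_root p0 pr0.
    by exists (n r), r; rewrite -pE.
  (* On the line [r = r0] the second equation holds for every [s]. *)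
  pose d := (r0 * b) ^+ 2 - (r0 ^+ 2 * w1 + r0 * l1 - t).
  have d0 : 0 <= d.
    have := sqr_ge0 (n r0 + r0 * b); move: pr0; rewrite pE /d /g; lra.
  exists (Num.sqrt d - r0 * b), r0; split; last by rewrite r0c mulr0.
  have := sqr_sqrtr d0; rewrite {2}/d; move: (Num.sqrt d) => q qd.
  by rewrite -(subrr (q ^+ 2)) {2}qd /g; ring.
(* Here [p] is [g] at the eliminated [s], with denominators cleared. It equals [N r0 ^+ 2 > 0] at
   the pole, so its root is not the pole. *)
pose p : {poly R} := (t%:P - l2 *: 'X - w2 *: 'X^2) ^+ 2
   + (2 * b) *: ((t%:P - l2 *: 'X - w2 *: 'X^2) * (1 + (2 * c) *: 'X) * 'X)
   + (1 + (2 * c) *: 'X) ^+ 2 * (w1 *: 'X^2 + l1 *: 'X - t%:P).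
have pE r : p.[r] = N r ^+ 2 + 2 * N r * (1 + 2 * r * c) * r * b
    + (1 + 2 * r * c) ^+ 2 * (r ^+ 2 * w1 + r * l1 - t).
  by rewrite /p !hornerE /= /N; ring.
have pr0 : 0 < p.[r0].
  rewrite pE r0c mulr0 !mul0r expr0n /= mul0r !addr0.
  by rewrite exprn_even_gt0.
have p0 : p.[0] <= 0 by rewrite pE /N; nra.
have [r pr] := poly_sign_root p0 (ltW pr0).
have rc : 1 + 2 * r * c != 0.
  apply: contraTneq pr0 => rc; rewrite -leNgt -pr.
  suff -> : r0 = r by [].
  by apply: (mulIf cn0); lra.
exists (N r / (1 + 2 * r * c)), r; rewrite divfK //; split => //.
apply: (mulfI (expf_neq0 2 rc)).
rewrite mulr0 -pr pE /g; move: (N r) rc => m.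
by move: (1 + 2 * r * c) => k kn0; field.
Qed.

(** Cramer's rule gives coordinates [cL], [cH] in the basis (L, H), which reduce this to
    [planar_normal]; the last hypothesis says that W has a nonzero L-coordinate. *)
Lemma planar_oblique {R : rcfType} (t L1 L2 H1 H2 B1 B2 W1 W2 l1 l2 : R) :
  0 <= t <= 1 -> L1 * H2 - L2 * H1 != 0 -> H2 * W1 - H1 * W2 != 0 ->
  exists s r : R,
    s * L1 + s ^+ 2 * H1 + 2 * s * r * B1 + r ^+ 2 * W1 + r * l1
      = t * (L1 + H1) /\
    s * L2 + s ^+ 2 * H2 + 2 * s * r * B2 + r ^+ 2 * W2 + r * l2
      = t * (L2 + H2).
Proof.
move=> t01; set D := _ - _ => D0 HW.
pose cL x1 x2 := (H2 * x1 - H1 * x2) / D.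
pose cH x1 x2 := (L1 * x2 - L2 * x1) / D.
have w0 : cL W1 W2 != 0 by rewrite mulf_neq0 ?invr_eq0.
have E1 x1 x2 : x1 = cL x1 x2 * L1 + cH x1 x2 * H1.
  by rewrite /cL /cH /D; field.
have E2 x1 x2 : x2 = cL x1 x2 * L2 + cH x1 x2 * H2.
  by rewrite /cL /cH /D; field.
have [s [r [e1 e2]]] := planar_normal t (cH B1 B2) (cH W1 W2) (cH l1 l2)
  (cL B1 B2) (cL W1 W2) (cL l1 l2) t01 w0.
exists s, r; split.
  rewrite (E1 B1 B2) (E1 W1 W2) (E1 l1 l2) [RHS]mulrDr -{1}e2 -e1; ring.
rewrite (E2 B1 B2) (E2 W1 W2) (E2 l1 l2) [RHS]mulrDr -{1}e2 -e1; ring.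
Qed.

Lemma planar_collinear {R : rcfType} (t L1 L2 H1 H2 : R) :
  0 <= t <= 1 -> L1 * H2 = L2 * H1 ->
  exists s : R, s * L1 + s ^+ 2 * H1 = t * (L1 + H1) /\
                s * L2 + s ^+ 2 * H2 = t * (L2 + H2).
Proof.
move=> t01 LH.
have root_of (L H : R) : exists s : R, s * L + s ^+ 2 * H = t * (L + H).
  wlog LH0 : L H / 0 <= L + H => [hw|].
    have [|LH0] := leP 0 (L + H); first exact: hw.
    have [|s hs] := hw (- L) (- H); first lra.
    exists s; lra.
  pose p : {poly R} := L *: 'X + H *: 'X^2 - (t * (L + H))%:P.
  have pE s : p.[s] = s * L + s ^+ 2 * H - t * (L + H).
    by rewrite /p !hornerE /=; ring.
  have [||s ps] := @poly_sign_root _ p 0 1; rewrite ?pE; [nra|nra|].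
  by exists s; apply/eqP; rewrite -subr_eq0 -pE ps.
(* Solve the equation in a coordinate where the chord [L + H] does not vanish; collinearity then
   forces the other one. *)
have [S10|S10] := eqVneq (L1 + H1) 0; last first.
  have [s hs] := root_of L1 H1; exists s; split => //.
  apply: (mulIf S10).
  have -> : (s * L2 + s ^+ 2 * H2) * (L1 + H1) =
    (s * L1 + s ^+ 2 * H1) * (L2 + H2)
      + (s ^+ 2 - s) * (L1 * H2 - L2 * H1) by ring.
  by rewrite hs LH; ring.
have [S20|S20] := eqVneq (L2 + H2) 0.
  by exists 0; rewrite S10 S20; split; ring.
have [s hs] := root_of L2 H2; exists s; split => //.
apply: (mulIf S20).
have -> : (s * L1 + s ^+ 2 * H1) * (L2 + H2) =
  (s * L2 + s ^+ 2 * H2) * (L1 + H1)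
    + (s - s ^+ 2) * (L1 * H2 - L2 * H1) by ring.
by rewrite hs LH; ring.
Qed.

(** * Quadratic forms and convexity of the joint range *)

Definition bform {R : comRingType} {n : nat} (A : 'M[R]_n) (x y : 'cV[R]_n) : R :=
  (x^T *m A *m y) 0 0.

Lemma bformC {R : comRingType} {n : nat} (A : 'M[R]_n) (x y : 'cV[R]_n) :
  A^T = A -> bform A x y = bform A y x.
Proof.
move=> symA; rewrite /bform.
have -> : x^T *m A *m y = (y^T *m A *m x)^T.
  by rewrite !trmx_mul trmxK symA mulmxA.
by rewrite mxE.
Qed.

Lemma bformDl {R : comRingType} {n : nat} (A : 'M[R]_n) (x y z : 'cV[R]_n) :
  bform A (x + y) z = bform A x z + bform A y z.
Proof. by rewrite /bform linearD !mulmxDl mxE. Qed.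

Lemma bformDr {R : comRingType} {n : nat} (A : 'M[R]_n) (x y z : 'cV[R]_n) :
  bform A z (x + y) = bform A z x + bform A z y.
Proof. by rewrite /bform mulmxDr mxE. Qed.

Lemma bformZl {R : comRingType} {n : nat} (A : 'M[R]_n) (k : R) (x y : 'cV[R]_n) :
  bform A (k *: x) y = k * bform A x y.
Proof. by rewrite /bform linearZ -!scalemxAl mxE. Qed.

Lemma bformZr {R : comRingType} {n : nat} (A : 'M[R]_n) (k : R) (x y : 'cV[R]_n) :
  bform A x (k *: y) = k * bform A x y.
Proof. by rewrite /bform -scalemxAr mxE. Qed.

Lemma bform_delta {R : comRingType} {n : nat} (A : 'M[R]_n) (i j : 'I_n) :
  bform A (delta_mx i 0) (delta_mx j 0) = A i j.
Proof. by rewrite /bform trmx_delta -rowE -colE !mxE. Qed.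

(** Polarization on pairs of basis vectors. *)
Lemma sym_form_eq0 {R : numFieldType} {n : nat} (A : 'M[R]_n) :
  A^T = A -> (forall x, bform A x x = 0) -> A = 0.
Proof.
move=> symA A0; apply/matrixP => i j; rewrite mxE -bform_delta.
have := A0 (delta_mx i 0 + delta_mx j 0).
rewrite bformDl !bformDr !A0 (bformC A (delta_mx j 0)) // addr0 add0r => /eqP.
by rewrite -mulr2n mulrn_eq0 /= => /eqP.
Qed.

Lemma quadratic_expand {R : realType} {n : nat} (A : 'M[R]_n) (a : 'cV[R]_n)
    (a0 s r : R) (x u w : 'cV[R]_n) : A^T = A ->
  quadratic A a a0 (x + s *: u + r *: w) = quadratic A a a0 x
    + (s * (2 * (bform A x u + (a^T *m u) 0 0)) + s ^+ 2 * bform A u u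
       + 2 * s * r * bform A u w + r ^+ 2 * bform A w w
       + r * (2 * (bform A x w + (a^T *m w) 0 0))).
Proof.
move=> symA; rewrite /quadratic -!/(bform _ _ _) !bformDl !bformDr.
rewrite !bformZl !bformZr !mulmxDr -!scalemxAr.
rewrite (bformC A u x) // (bformC A w x) // (bformC A w u) //.
rewrite ![(_ + _ : 'M_1) 0 0]mxE ![(_ *: _ : 'M_1) 0 0]mxE.
ring.
Qed.

Lemma joint_range_convex {R : realType} {n : nat} (A1 A2 : 'M[R]_n)
    (a b : 'cV[R]_n) (a0 b0 t : R) (x y : 'cV[R]_n) :
  A1^T = A1 -> A2^T = A2 -> free [:: A1; A2] -> 0 <= t <= 1 ->
  exists z, quadratic A1 a a0 z =
      quadratic A1 a a0 x + t * (quadratic A1 a a0 y - quadratic A1 a a0 x) /\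
    quadratic A2 b b0 z =
      quadratic A2 b b0 x + t * (quadratic A2 b b0 y - quadratic A2 b b0 x).
Proof.
move=> sym1 sym2 indep t01; pose u := y - x.
pose H1 := bform A1 u u; pose H2 := bform A2 u u.
pose L1 := 2 * (bform A1 x u + (a^T *m u) 0 0).
pose L2 := 2 * (bform A2 x u + (b^T *m u) 0 0).
have yE : y = x + 1 *: u + 0 *: u by rewrite scale1r scale0r addr0 subrKC.
have f1y : quadratic A1 a a0 y - quadratic A1 a a0 x = L1 + H1.
  by rewrite yE quadratic_expand // /L1 /H1; ring.
have f2y : quadratic A2 b b0 y - quadratic A2 b b0 x = L2 + H2.
  by rewrite yE quadratic_expand // /L2 /H2; ring.
rewrite f1y f2y.
have [/eqP|LH] := eqVneq (L1 * H2 - L2 * H1) 0.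
  rewrite subr_eq0 => /eqP LH.
  have [s [s1 s2]] := planar_collinear t L1 L2 H1 H2 t01 LH.
  exists (x + s *: u + 0 *: u); rewrite !quadratic_expand //.
  by rewrite -s1 -s2 /L1 /L2 /H1 /H2; split; ring.
(* Otherwise [H2 *: A1 - H1 *: A2] vanishes as a form, hence as a matrix, and independence gives
   [H1 = H2 = 0], against [LH]. *)
have [w w0] : exists w, H2 * bform A1 w w - H1 * bform A2 w w != 0.
  apply/not_existsP => noW.
  have M0 : H2 *: A1 - H1 *: A2 = 0.
    apply: sym_form_eq0; first by rewrite linearB !linearZ /= sym1 sym2.
    move=> w; have /negP := noW w; rewrite negbK => /eqP <-.
    rewrite /bform mulmxBr mulmxBl -!scalemxAr -!scalemxAl !mxE //.
  have /freeP/(_ (fun i => if i == 0 then H2 else - H1)) : free [tuple A1; A2].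
    exact: indep.
  rewrite !big_ord_recl big_ord0 /= addr0 scaleNr => /(_ M0) hk.
  have /eqP := hk 1; rewrite /= oppr_eq0 => /eqP h1.
  by have h2 := hk 0; move: LH; rewrite h1 [H2]h2 !mulr0 subrr eqxx.
have [s [r [e1 e2]]] := planar_oblique t L1 L2 H1 H2 (bform A1 u w)
  (bform A2 u w) _ _ (2 * (bform A1 x w + (a^T *m w) 0 0))
  (2 * (bform A2 x w + (b^T *m w) 0 0)) t01 LH w0.
exists (x + s *: u + r *: w); rewrite !quadratic_expand //.
by rewrite -e1 -e2.
Qed.

(** * Projection of the origin on the closure of a convex planar set *)

(** A Cauchy criterion without sequences: the limit is the supremum of the numbers that bound [h]
    from below on some [N e] with [0 < e]. *)
Lemma nested_limit {R : realType} {T : Type} (N : R -> T -> Prop) (h : T -> R) :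
  (forall e e', e <= e' -> N e `<=` N e') -> (forall e, 0 < e -> N e !=set0) ->
  (forall e x y, 0 < e -> N e x -> N e y -> h x <= h y + e) ->
  exists p, forall e x, 0 < e -> N e x -> `|h x - p| <= e.
Proof.
move=> Nmono Nne Nosc.
pose S := [set y | exists2 e, 0 < e & forall x, N e x -> y <= h x].
have ubS e x : 0 < e -> N e x -> ubound S (h x + e).
  move=> e0 Nx y [e' e'0 ye'].
  have [z Nz] : N (Num.min e e') !=set0 by apply: Nne; rewrite lt_min e0.
  apply: (le_trans (ye' z _)); first by apply: Nmono Nz; rewrite ge_min lexx orbT.
  by apply: Nosc => //; apply: Nmono Nz; rewrite ge_min lexx.
have memS e x : 0 < e -> N e x -> S (h x - e).
  by move=> e0 Nx; exists e => // y Ny; rewrite lerBlDr Nosc.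
exists (sup S) => e x e0 Nx; rewrite ler_distlC; apply/andP; split.
  by apply: ub_le_sup; [exists (h x + e); exact: ubS|exact: memS].
by apply: ge_sup; [exists (h x - e); exact: memS|exact: ubS].
Qed.

(* [(p1, p2)] is the projection of the origin on the closure of the convex set
   parametrized by [g1] and [g2], obtained as a limit of near-minimizers; the
   parallelogram identity makes those of tolerance [e ^+ 2 / 4] [e]-close. *)
Lemma nearest_point {R : realType} {T : Type} (g1 g2 : T -> R) (d : R) :
  (forall x y t, 0 <= t <= 1 -> exists z, g1 z = g1 x + t * (g1 y - g1 x) /\
     g2 z = g2 x + t * (g2 y - g2 x)) ->
  (forall x, d <= g1 x ^+ 2 + g2 x ^+ 2) ->
  (forall e, 0 < e -> exists x, g1 x ^+ 2 + g2 x ^+ 2 <= d + e) ->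
  exists p1 p2,
    forall x, d <= 2 * (p1 * g1 x + p2 * g2 x) - (p1 ^+ 2 + p2 ^+ 2).
Proof.
move=> conv dmin dinf.
(* The conjunct [0 < e] makes [N] monotone on all of [R], where [e ^+ 2] is not. *)
pose N e x := 0 < e /\ g1 x ^+ 2 + g2 x ^+ 2 <= d + e ^+ 2 / 4.
have Nmono e e' : e <= e' -> N e `<=` N e'.
  move=> ee' x [e0 Nx]; split; first exact: lt_le_trans ee'.
  by apply: (le_trans Nx); rewrite lerD2l ler_pM2r ?invr_gt0// lerXn2r ?nnegrE; lra.
have Nne e : 0 < e -> N e !=set0.
  move=> e0; have [|x xe] := dinf (e ^+ 2 / 4).
    by rewrite divr_gt0 ?exprn_gt0.
  by exists x.
have diam e x y : N e x -> N e y ->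
    (g1 x - g1 y) ^+ 2 + (g2 x - g2 y) ^+ 2 <= e ^+ 2.
  move=> [_ Nx] [_ Ny]; have [|z [z1 z2]] := conv x y 2^-1; first lra.
  by have := dmin z; rewrite z1 z2; nra.
have [e x y e0 Nx Ny|p1 p1P] := nested_limit N g1 Nmono Nne.
  rewrite leNgt; apply/negP => exy.
  by have := diam _ _ _ Nx Ny; have := sqr_ge0 (g2 x - g2 y); nra.
have [e x y e0 Nx Ny|p2 p2P] := nested_limit N g2 Nmono Nne.
  rewrite leNgt; apply/negP => exy.
  by have := diam _ _ _ Nx Ny; have := sqr_ge0 (g1 x - g1 y); nra.
exists p1, p2 => y; set X := _ - _; rewrite leNgt; apply/negP => Xd.
pose K := 2 * (g1 y ^+ 2 + g2 y ^+ 2) + 2 * (d + 1).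
(* First-order optimality at a near-minimizer [x]: a step of length [e] towards [y] cannot go below
   [d], so the slope [2 * (g1 x * v1 + g2 x * v2)] is at least of order [- e]. Replacing [g x] by
   [p] costs another multiple of [e]. *)
have bound e x : e <= 1 -> N e x -> d - X <= e * (5 + 2 * K).
  move=> e1 Nx; have [e0 qx] := Nx.
  have [|z [z1 z2]] := conv x y e; first by rewrite e1 ltW.
  pose v1 := g1 y - g1 x; pose v2 := g2 y - g2 x.
  have vK : v1 ^+ 2 + v2 ^+ 2 <= K.
    have e21 : e ^+ 2 <= 1 by rewrite expr_le1 // ltW.
    have := sqr_ge0 (g1 y + g1 x); have := sqr_ge0 (g2 y + g2 x).
    by rewrite /K /v1 /v2; lra.
  have cross (p g v : R) : `|g - p| <= e ->
      - (e * (1 + v ^+ 2)) <= 2 * ((p - g) * v) /\ (p - g) ^+ 2 <= e.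
    rewrite ler_distlC => /andP[h1 h2]; split; last nra.
    have le1 : 0 <= (e + (p - g)) * (1 + v) ^+ 2.
      by rewrite mulr_ge0 ?sqr_ge0//; lra.
    have le2 : 0 <= (e - (p - g)) * (1 - v) ^+ 2.
      by rewrite mulr_ge0 ?sqr_ge0//; lra.
    lra.
  have [c1 s1] := cross _ _ v1 (p1P e x e0 Nx).
  have [c2 s2] := cross _ _ v2 (p2P e x e0 Nx).
  have slope : - (e * (1 + K)) <= 2 * (g1 x * v1 + g2 x * v2).
    rewrite -(ler_pM2l e0); have := dmin z; rewrite z1 z2 -/v1 -/v2 => dz.
    have : e ^+ 2 * (v1 ^+ 2 + v2 ^+ 2) <= e ^+ 2 * K.
      by rewrite ler_wpM2l ?sqr_ge0.
    by have := sqr_ge0 e; lra.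
  have -> : X = g1 x ^+ 2 + g2 x ^+ 2 + 2 * (g1 x * v1 + g2 x * v2)
      + 2 * ((p1 - g1 x) * v1) + 2 * ((p2 - g2 x) * v2)
      - (p1 - g1 x) ^+ 2 - (p2 - g2 x) ^+ 2.
    by rewrite /X /v1 /v2; ring.
  have := dmin x; have : e * (v1 ^+ 2 + v2 ^+ 2) <= e * K.
    by rewrite ler_wpM2l // ltW.
  lra.
(* With this [e], [bound] would give [d - X <= (d - X) / 2]. *)
pose e := Num.min 1 ((d - X) / (2 * (5 + 2 * K))).
have [x0 [_ x0P]] := Nne 1 ltr01.
have K0 : 0 <= K.
  rewrite /K; have := sqr_ge0 (g1 y); have := sqr_ge0 (g2 y).
  by have := sqr_ge0 (g1 x0); have := sqr_ge0 (g2 x0); lra.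
have e0 : 0 < e by rewrite lt_min ltr01 divr_gt0; lra.
have [x Nx] := Nne e e0.
have e1 : e <= 1 by rewrite ge_min lexx.
have eX : e <= (d - X) / (2 * (5 + 2 * K)) by rewrite ge_min lexx orbT.
have := bound e x e1 Nx; move: eX; rewrite ler_pdivlMr; lra.
Qed.

(** * The matrix inequality as a Lagrangian bound *)

Lemma quad_bounded_lead {R : realFieldType} (q l k : R) :
  (forall s, 0 <= s ^+ 2 * q + s * l + k) -> 0 <= q.
Proof.
move=> pos; rewrite leNgt; apply/negP => q0.
(* Adding the values at [s] and [- s] cancels the linear term, and this [s] makes
   [s ^+ 2 * q + k <= q < 0]. *)
pose s := 1 + `|k| / (- q).
have s1 : 1 <= s by rewrite lerDl divr_ge0 // oppr_ge0 ltW.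
have sq : s * q = q - `|k| by rewrite /s; field; rewrite lt_eqF.
have ssq : s ^+ 2 * q <= s * q by apply: ler_wnM2r; [exact: ltW|exact: ler_eXnr].
by have := pos s; have := pos (- s); have := ler_norm k; lra.
Qed.

Lemma dotC {R : comRingType} {n : nat} (x y : 'cV[R]_n) :
  x^T *m y = y^T *m x.
Proof.
by rewrite -[RHS]trmxK trmx_mul trmxK [RHS]mx11_scalar mxE -mx11_scalar.
Qed.

(** Completing the squares in [u] exposes the Schur complement of the identity block, which produces
    the term [(alpha ^+ 2 + beta ^+ 2) / 4]. *)
Lemma lmi_mx_form {R : realType} {n : nat} (A1 A2 : 'M[R]_n) (a b x : 'cV[R]_n)
    (a0 b0 gamma alpha beta tau : R) (u : 'cV[R]_2) :
  bform (lmi_mx A1 A2 a b a0 b0 gamma alpha beta) (col_mx (col_mx u x) tau%:M)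
    (col_mx (col_mx u x) tau%:M) =
  (u 0 0 - tau * alpha / 2) ^+ 2 + (u 1 0 - tau * beta / 2) ^+ 2
  + (alpha * bform A1 x x + beta * bform A2 x x
     + tau * (2 * (alpha * (a^T *m x) 0 0 + beta * (b^T *m x) 0 0))
     + tau ^+ 2 * (alpha * a0 + beta * b0 - gamma
                   - (alpha ^+ 2 + beta ^+ 2) / 4)).
Proof.
rewrite /bform /lmi_mx; set c := \col_i _; set d := _ + _ : 'cV_n.
rewrite !tr_col_mx !mul_row_block !mul_row_col.
rewrite !mulmx0 !addr0 !add0r !mulmx1.
rewrite tr_scalar_mx !mul_scalar_mx mul_mx_scalar scale_row_mx add_row_mx.
rewrite mul_row_col !mulmxDl -!scalemxAl (dotC u c) (dotC x d).
rewrite !mulmxDr !mulmxDl -!scalemxAr -!scalemxAl.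
have -> : d^T = alpha *: a^T + beta *: b^T by rewrite linearD !linearZ.
rewrite mulmxDl -!scalemxAl.
move: (x^T *m A1 *m x) (x^T *m A2 *m x) (a^T *m x) (b^T *m x) => q1 q2 l1 l2.
have uu : (u^T *m u) 0 0 = u 0 0 ^+ 2 + u 1 0 ^+ 2.
  rewrite mxE !big_ord_recl big_ord0 !mxE (_ : lift _ _ = 1) ?addr0 //.
  exact: val_inj.
have cu : (c^T *m u) 0 0 = - (alpha * u 0 0 + beta * u 1 0) / 2.
  rewrite mxE !big_ord_recl big_ord0 !mxE (_ : lift _ _ = 1) /=; last first.
    exact: val_inj.
  by rewrite addr0; field.
move: uu cu; move: (u^T *m u) (c^T *m u) => m1 m2 uu cu.
rewrite !mxE uu cu eqxx !mulr1n.
by field.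
Qed.

Lemma lmi_mx_sym {R : realType} {n : nat} (A1 A2 : 'M[R]_n) (a b : 'cV[R]_n)
    (a0 b0 gamma alpha beta : R) : A1^T = A1 -> A2^T = A2 ->
  (lmi_mx A1 A2 a b a0 b0 gamma alpha beta)^T
    = lmi_mx A1 A2 a b a0 b0 gamma alpha beta.
Proof.
move=> sym1 sym2; rewrite /lmi_mx !tr_block_mx tr_row_mx tr_col_mx !trmxK.
by rewrite !trmx0 !tr_scalar_mx !linearD !linearZ /= sym1 sym2.
Qed.

Lemma psd_lmi_mxP {R : realType} {n : nat} (A1 A2 : 'M[R]_n) (a b : 'cV[R]_n)
    (a0 b0 gamma alpha beta : R) : A1^T = A1 -> A2^T = A2 ->
  psdmx (lmi_mx A1 A2 a b a0 b0 gamma alpha beta) <->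
  forall x, gamma <= alpha * quadratic A1 a a0 x + beta * quadratic A2 b b0 x
                     - (alpha ^+ 2 + beta ^+ 2) / 4.
Proof.
move=> sym1 sym2; split=> [[_ psd] x|lag].
  (* With [tau = 1], this [u] makes both squares vanish. *)
  pose u : 'cV[R]_2 := \col_i ((if i == 0 then alpha else beta) / 2).
  have := psd (col_mx (col_mx u x) 1%:M).
  have u0 : u 0 0 = alpha / 2 by rewrite mxE.
  have u1 : u 1 0 = beta / 2 by rewrite mxE.
  rewrite -/(bform _ _ _) lmi_mx_form u0 u1 /quadratic -!/(bform _ _ _).
  by rewrite !mul1r !subrr expr1n; lra.
split=> [|v]; first exact: lmi_mx_sym.
rewrite -[v]vsubmxK -[usubmx v]vsubmxK [dsubmx v]mx11_scalar -/(bform _ _ _).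
move: (usubmx (usubmx v)) (dsubmx (usubmx v)) (dsubmx v 0 0) => u x tau.
rewrite lmi_mx_form; apply: addr_ge0; first by rewrite addr_ge0 ?sqr_ge0.
set q := alpha * _ + beta * _; set l := 2 * _; set k := _ - _ / 4.
(* The bound along the ray [s *: x]: taking [s = tau^-1] settles [tau != 0], and the leading
   coefficient in [s] settles [tau = 0]. *)
have hom s : 0 <= s ^+ 2 * q + s * l + k.
  have := lag (s *: x); rewrite /quadratic -!/(bform _ _ _).
  rewrite !bformZl !bformZr -!scalemxAr ![(_ *: _ : 'M_1) 0 0]mxE.
  by rewrite /q /l /k; lra.
have [->|tau0] := eqVneq tau 0.
  by rewrite expr0n !mul0r !addr0; exact: quad_bounded_lead hom.
have -> : q + tau * l + tau ^+ 2 * k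
  = tau ^+ 2 * (tau^-1 ^+ 2 * q + tau^-1 * l + k) by field.
by rewrite mulr_ge0 ?sqr_ge0.
Qed.

Theorem theorem8 (R : realType) (n : nat) (A1 A2 : 'M[R]_n)
    (a b : 'cV[R]_n) (a0 b0 : R)
    (symA1 : A1^T = A1) (symA2 : A2^T = A2)
    (indep : free [:: A1; A2]) :
  v_Po4 A1 A2 a b a0 b0 =
  ereal_sup [set gamma%:E | gamma in [set gamma : R | exists alpha beta : R,
    psdmx (lmi_mx A1 A2 a b a0 b0 gamma alpha beta)]].
Proof.
rewrite /v_Po4; set f1 := quadratic A1 a a0; set f2 := quadratic A2 b b0.
set V := (X in ereal_inf X).
have V_fin : ereal_inf V \is a fin_num.
  rewrite fin_numE -ltNye -ltey (@lt_le_trans _ _ 0%:E) ?ltNyr//=.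
    apply: le_lt_trans (ltry (f1 0 ^+ 2 + f2 0 ^+ 2)).
    by apply: ereal_inf_lbound; exists 0.
  by apply: le_ereal_inf_tmp => _ [x _ <-]; rewrite lee_fin addr_ge0 ?sqr_ge0.
apply/eqP; rewrite eq_le; apply/andP; split; last first.
  (* Weak duality: [f ^+ 2 >= alpha * f - alpha ^+ 2 / 4] for each of the two functions, with its
     own multiplier. *)
  apply: ge_ereal_sup => _ [gamma [alpha [beta psd]] <-].
  apply: le_ereal_inf_tmp => _ [x _ <-]; rewrite lee_fin.
  have /psd_lmi_mxP := psd; move=> /(_ symA1 symA2 x); rewrite -/f1 -/f2.
  have := sqr_ge0 (f1 x - alpha / 2); have := sqr_ge0 (f2 x - beta / 2); lra.
have [||| p1 [p2 pP]] := nearest_point f1 f2 (fine (ereal_inf V)).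
- by move=> x y t t01; exact: joint_range_convex.
- move=> x; rewrite -lee_fin fineK //.
  by apply: ereal_inf_lbound; exists x.
- move=> e e0; have [_ [x _ <-]] := lb_ereal_inf_adherent e0 V_fin.
  by rewrite -(fineK V_fin) -EFinD lte_fin => /ltW; exists x.
rewrite -(fineK V_fin); apply: ereal_sup_ubound.
(* For the multipliers [2 * p1] and [2 * p2] the penalty is [p1 ^+ 2 + p2 ^+ 2], so [pP] is the
   Lagrangian bound and the supremum is attained. *)
exists (fine (ereal_inf V)) => //; exists (2 * p1), (2 * p2).
apply/psd_lmi_mxP => // x; have := pP x; rewrite -/f1 -/f2; lra.
Qed.
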